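(* Let $k$ be a field and let $\mathfrak{g}$ and $\mathfrak{h}$ be Leibniz algebras over $k$ such that $\mathfrak{h}$ is finite dimensional. Then the map $$\gamma : \mathrm{Hom}_{\mathrm{Alg}_k}(\mathcal{A}(\mathfrak{h},\mathfrak{g}), k) \to \mathrm{Hom}_{\mathrm{Lbz}_k}(\mathfrak{g},\mathfrak{h}), \qquad \gamma(\theta) := (\mathrm{Id}_{\mathfrak{h}}\otimes\theta)\circ\eta_{\mathfrak{g}}$$ is bijective, where $\mathfrak{h}\otimes k$ is identified with $\mathfrak{h}$ in the canonical way.
   Context: All vector spaces, algebras and tensor products are over an arbitrary field $k$; algebras are unital and algebra homomorphisms preserve units. A Leibniz algebra is a vector space $\mathfrak{h}$ with a bilinear map $[-,-]$ satisfying $[x,[y,z]] = [[x,y],z]-[[x,z],y]$ for all $x,y,z$; homomorphisms are bracket-preserving linear maps. For a Leibniz algebra $\mathfrak{h}$ and a commutative algebra $A$, $\mathfrak{h}\otimes A$ is the Leibniz algebra with bracket $[x\otimes a,y\otimes b]:=[x,y]\otimes ab$. Definition of $\mathcal{A}(\mathfrak{h},\mathfrak{g})$ and $\eta_{\mathfrak{g}}$: let $\{e_1,\dots,e_n\}$ be a basis of the finite dimensional Leibniz algebra $\mathfrak{h}$, with structure constants $[e_i,e_j]=\sum_{s=1}^n\tau_{i,j}^s e_s$, and let $\{f_i \mid i\in I\}$ be a basis of $\mathfrak{g}$, with $[f_i,f_j]=\sum_{u\in B_{i,j}}\beta_{i,j}^u f_u$, where each $B_{i,j}\subseteq I$ is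 finite. Then $\mathcal{A}(\mathfrak{h},\mathfrak{g}) := k[X_{si}\mid s=1,\dots,n,\ i\in I]/J$, where $J$ is the ideal generated by all polynomials $$\sum_{u\in B_{i,j}}\beta_{i,j}^u X_{au}-\sum_{s,t=1}^n\tau_{s,t}^a X_{si}X_{tj},\qquad a=1,\dots,n,\ i,j\in I.$$ Write $x_{si}$ for the class of $X_{si}$. The map $\eta_{\mathfrak{g}}:\mathfrak{g}\to\mathfrak{h}\otimes\mathcal{A}(\mathfrak{h},\mathfrak{g})$ is the linear map (a Leibniz algebra homomorphism) given by $\eta_{\mathfrak{g}}(f_i):=\sum_{s=1}^n e_s\otimes x_{si}$ for all $i\in I$. *)

(* Defs.v *)
From HB Require Import structures.
From mathcomp Require Import all_boot all_algebra.
From mathcomp Require Import boolp xfinmap monalg.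

Set Implicit Arguments.
Unset Strict Implicit.
Unset Printing Implicit Defensive.

Import GRing.Theory.
Local Open Scope ring_scope.
Local Open Scope quotient_scope.

HB.mixin Record Lmodule_isLeibniz (k : fieldType) L of GRing.Lmodule k L := {
  lbr : L -> L -> L;
  lbr_linear_l : forall y, linear (lbr^~ y);
  lbr_linear_r : forall x, linear (lbr x);
  lbr_leibniz : forall x y z, lbr x (lbr y z) = lbr (lbr x y) z - lbr (lbr x z) y
}.

#[short(type="leibnizType")]
HB.structure Definition Leibniz (k : fieldType) :=
  {L of GRing.Lmodule k L & Lmodule_isLeibniz k L}.

#[short(type="fdLeibnizType")]
HB.structure Definition FdLeibniz (k : fieldType) :=
  {L of Vector k L & Lmodule_isLeibniz k L}.

Record lbzHom (k : fieldType) (g h : leibnizType k) := LbzHom {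
  lbz_fun :> {linear g -> h};
  lbz_funE : {morph lbz_fun : x y / lbr x y >-> lbr x y}
}.

Section Basis.
Context (k : fieldType) (I : choiceType).

(* The elements of {malg k[I]} are the finitely supported families I -> k. *)
Definition lincomb (V : lmodType k) (f : I -> V) (c : {malg k[I]}) : V :=
  \sum_(i <- msupp c) c@_i *: f i.

Definition is_basis (V : lmodType k) (f : I -> V) : Prop :=
  (forall c, lincomb f c = 0 -> c = 0) /\ (forall x, exists c, x = lincomb f c).

Lemma lincombEw (V : lmodType k) (f : I -> V) (d : {fset I}) c :
  (msupp c `<=` d)%fset -> lincomb f c = \sum_(i <- d) c@_i *: f i.
Proof.
move=> le; rewrite [LHS](big_fset_incl _ le) => //= i _ /mcoeff_outdom ->.
by rewrite scale0r.
Qed.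

Lemma lincomb_is_linear (V : lmodType k) (f : I -> V) : linear (lincomb f).
Proof.
move=> a x y; set d := (msupp (a *: x + y) `|` msupp x `|` msupp y)%fset.
rewrite !(@lincombEw _ _ d); last 3 first.
- by rewrite /d fsubsetUr.
- by apply/fsubsetP=> i xi; rewrite !inE xi orbT.
- by apply/fsubsetP=> i xi; rewrite !inE xi.
rewrite scaler_sumr -big_split /=; apply: eq_bigr => i _.
by rewrite mcoeffD mcoeffZ scalerDl scalerA.
Qed.

HB.instance Definition _ (V : lmodType k) (f : I -> V) :=
  GRing.isLinear.Build k {malg k[I]} V *:%R (lincomb f) (lincomb_is_linear f).

Lemma lincombU (V : lmodType k) (f : I -> V) c i :
  lincomb f << c *g i >> = c *: f i.
Proof. by rewrite (lincombEw _ msuppU_le) big_seq_fset1 mcoeffUU. Qed.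

Section Coordinates.
Context (V : lmodType k) (f : I -> V) (hf : is_basis f).

Definition bcoord (x : V) : {malg k[I]} := projT1 (cid (hf.2 x)).

Lemma bcoordK x : lincomb f (bcoord x) = x.
Proof. by rewrite /bcoord; case: cid. Qed.

Lemma bcoord_uniq x c : x = lincomb f c -> bcoord x = c.
Proof.
move=> xc; apply/eqP; rewrite -subr_eq0; apply/eqP/hf.1.
by rewrite raddfB /= bcoordK xc subrr.
Qed.

(* The linear map sending each basis vector [f i] to [F i]. *)
Definition linext (U : lmodType k) (F : I -> U) (x : V) : U :=
  lincomb F (bcoord x).

Lemma linext_is_linear (U : lmodType k) (F : I -> U) : linear (linext F).
Proof.
move=> a x y; rewrite /linext -linearP; congr (lincomb _ _).
by apply: bcoord_uniq; rewrite linearP /= !bcoordK.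
Qed.

HB.instance Definition _ (U : lmodType k) (F : I -> U) :=
  GRing.isLinear.Build k V U *:%R (linext F) (linext_is_linear F).

Lemma linext_basis (U : lmodType k) (F : I -> U) i : linext F (f i) = F i.
Proof.
rewrite /linext (@bcoord_uniq _ << 1 *g i >>) ?lincombU ?scale1r //.
Qed.

Lemma eq_on_basis (U : lmodType k) (p q : V -> U) :
  linear p -> linear q -> (forall i, p (f i) = q (f i)) -> p =1 q.
Proof.
move=> hp hq pq x; rewrite -[x]bcoordK /lincomb.
pose P := HB.pack_for {linear V -> U} p (GRing.isLinear.Build k V U *:%R p hp).
pose Q := HB.pack_for {linear V -> U} q (GRing.isLinear.Build k V U *:%R q hq).
have -> : p = P by []. have -> : q = Q by [].
rewrite !linear_sum; apply: eq_bigr => i _.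
by rewrite !linearZ /= pq.
Qed.

End Coordinates.
End Basis.

Section Tensor.
Context (k : fieldType) (V W : lmodType k).

Local Notation free := {malg k[(V * W)%type]}.

(* The subspace of the free vector space on V * W spanned by the bilinearity
   relations. *)
Inductive tensor_rel : free -> Prop :=
| TensorRel0 : tensor_rel 0
| TensorRelD x y : tensor_rel x -> tensor_rel y -> tensor_rel (x + y)
| TensorRelZ a x : tensor_rel x -> tensor_rel (a *: x)
| TensorRelL a v v' w :
    tensor_rel (<< (a *: v + v', w) >> - (a *: << (v, w) >> + << (v', w) >>))
| TensorRelR a v w w' :
    tensor_rel (<< (v, a *: w + w') >> - (a *: << (v, w) >> + << (v, w') >>)).

Definition tensor_null : {pred free} := fun z => `[< tensor_rel z >].

Lemma tensor_null_zmod : zmod_closed tensor_null.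
Proof.
split=> [|x y /asboolP hx /asboolP hy]; apply/asboolP; first exact: TensorRel0.
by apply: TensorRelD => //; rewrite -scaleN1r; apply: TensorRelZ.
Qed.

HB.instance Definition _ :=
  GRing.isZmodClosed.Build free tensor_null tensor_null_zmod.

Definition tensor := Quotient.quot tensor_null.
HB.instance Definition _ := Choice.on tensor.
HB.instance Definition _ := EqQuotient.on tensor.
HB.instance Definition _ := GRing.Zmodule.on tensor.
HB.instance Definition _ := ZmodQuotient.on tensor.

Lemma tensor_eqP (x y : free) :
  reflect (\pi_tensor x = \pi_tensor y) (`[< tensor_rel (x - y) >]).
Proof.
apply: (iffP idP) => [h|/eqP]; last by rewrite -Quotient.idealrBE.
by apply/eqP; rewrite -Quotient.idealrBE.
Qed.

Definition tensor_scale (a : k) : tensor -> tensor := lift_op1 tensor ( *:%R a).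

Lemma pi_tensor_scale a (x : free) :
  \pi_tensor (a *: x) = tensor_scale a (\pi_tensor x).
Proof.
unlock tensor_scale; apply/tensor_eqP/asboolP; rewrite -scalerBr; apply: TensorRelZ.
by apply/asboolP/tensor_eqP; rewrite reprK.
Qed.

Lemma tensor_scalerA a b x :
  tensor_scale a (tensor_scale b x) = tensor_scale (a * b) x.
Proof. by rewrite -[x]reprK -!pi_tensor_scale scalerA. Qed.
Lemma tensor_scale1r : left_id 1 tensor_scale.
Proof. by move=> x; rewrite -[x]reprK -!pi_tensor_scale scale1r. Qed.
Lemma tensor_scalerDr : right_distributive tensor_scale +%R.
Proof.
move=> a x y; rewrite -[x]reprK -[y]reprK -raddfD -!pi_tensor_scale.
by rewrite -raddfD scalerDr.
Qed.
Lemma tensor_scalerDl x : {morph tensor_scale^~ x : a b / a + b}.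
Proof. by move=> a b; rewrite -[x]reprK -!pi_tensor_scale -raddfD scalerDl. Qed.

HB.instance Definition _ := GRing.Zmodule_isLmodule.Build k tensor
  tensor_scalerA tensor_scale1r tensor_scalerDr tensor_scalerDl.

Lemma pi_tensor_linear : linear \pi_tensor.
Proof. by move=> a x y; rewrite raddfD /= pi_tensor_scale. Qed.

Definition tensor_proj : free -> tensor := \pi_tensor.
HB.instance Definition _ := GRing.isLinear.Build k free tensor *:%R
  tensor_proj pi_tensor_linear.

Definition tens (v : V) (w : W) : tensor := \pi_tensor << (v, w) >>.

Lemma tensorE (x : tensor) :
  x = \sum_(p <- msupp (repr x)) (repr x)@_p *: tens p.1 p.2.
Proof.
rewrite -[x in LHS]reprK [in LHS](monalgE (repr x)).
rewrite -[LHS]/(tensor_proj _) raddf_sum /=.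
apply: eq_bigr => -[v w] _ /=; rewrite -[tens v w]/(tensor_proj _) -linearZ /=.
congr (tensor_proj _).
by apply/malgP=> q; rewrite mcoeffZ !mcoeffU mulr_natr.
Qed.

Lemma tens_linear_l w : linear (tens^~ w).
Proof.
move=> a v v'; rewrite /tens -pi_tensor_linear.
by apply/tensor_eqP/asboolP/TensorRelL.
Qed.

Lemma tens_linear_r v : linear (tens v).
Proof.
move=> a w w'; rewrite /tens -pi_tensor_linear.
by apply/tensor_eqP/asboolP/TensorRelR.
Qed.

Definition tens_lmap w : V -> tensor := tens^~ w.
HB.instance Definition _ w := GRing.isLinear.Build k V tensor *:%R
  (tens_lmap w) (tens_linear_l w).
HB.instance Definition _ v := GRing.isLinear.Build k W tensor *:%R
  (tens v) (tens_linear_r v).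

(* The linear map induced by [b], computed on a representative; this is
   meaningful when [b] is bilinear, see [tlift_tens] and [tlift_linear]. *)
Definition tlift (U : lmodType k) (b : V -> W -> U) (x : tensor) : U :=
  lincomb (fun p : V * W => b p.1 p.2) (repr x).

Section Lift.
Context (U : lmodType k) (b : V -> W -> U).
Hypotheses (bl : forall w, linear (b^~ w)) (br : forall v, linear (b v)).

Lemma tlift_pi (x : free) :
  tlift b (\pi x) = lincomb (fun p : V * W => b p.1 p.2) x.
Proof.
apply/eqP; rewrite -subr_eq0 /tlift -raddfB /=; apply/eqP.
have : tensor_rel (repr (\pi_tensor x) - x).
  by apply/asboolP/tensor_eqP; rewrite reprK.
elim=> [|y z _ hy _ hz|a y _ hy|a v v' w|a v w w'].
- by rewrite raddf0.
- by rewrite raddfD /= hy hz addr0.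
- by rewrite linearZ /= hy scaler0.
- by rewrite raddfB /= linearP /= !lincombU /= !scale1r bl subrr.
- by rewrite raddfB /= linearP /= !lincombU /= !scale1r br subrr.
Qed.

Lemma tlift_tens v w : tlift b (tens v w) = b v w.
Proof. by rewrite tlift_pi lincombU scale1r. Qed.

Lemma tlift_linear : linear (tlift b).
Proof.
move=> a x y; rewrite -[x]reprK -[y]reprK -pi_tensor_linear !tlift_pi.
by rewrite linearP.
Qed.
End Lift.

End Tensor.

Arguments tens {k V W} v w.
Arguments tens_lmap {k} V {W} w.

Definition tmap (k : fieldType) (V W V' W' : lmodType k)
    (p : V -> V') (q : W -> W') : tensor V W -> tensor V' W' :=
  tlift (fun v w => tens (p v) (q w)).

Definition tensor_unit (k : fieldType) (V : lmodType k) : tensor V k^o -> V :=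
  tlift (fun (v : V) (c : k^o) => (c : k) *: v).

Section TensorMap.
Context (k : fieldType) (V W V' W' : lmodType k).
Context (p : {linear V -> V'}) (q : {linear W -> W'}).

Let bl w : linear (fun v => tens (p v) (q w)).
Proof. by move=> a v v'; rewrite linearP tens_linear_l. Qed.
Let br v : linear (fun w => tens (p v) (q w)).
Proof. by move=> a w w'; rewrite linearP tens_linear_r. Qed.

Lemma tmap_tens v w : tmap p q (tens v w) = tens (p v) (q w).
Proof. exact: (tlift_tens bl br). Qed.

Lemma tmap_is_linear : linear (tmap p q).
Proof. exact: (tlift_linear bl br). Qed.

HB.instance Definition _ := GRing.isLinear.Build k (tensor V W) (tensor V' W')
  *:%R (tmap p q) tmap_is_linear.
End TensorMap.

Section TensorUnit.
Context (k : fieldType) (V : lmodType k).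

Let bl (c : k^o) : linear (fun v : V => (c : k) *: v).
Proof. by move=> a v v'; rewrite scalerDr !scalerA mulrC. Qed.
Let br (v : V) : linear (fun c : k^o => (c : k) *: v).
Proof. by move=> a c c'; rewrite scalerDl scalerA. Qed.

Lemma tensor_unit_tens (v : V) (c : k) : tensor_unit (tens v (c : k^o)) = c *: v.
Proof. exact: (tlift_tens bl br). Qed.

Lemma tensor_unit_is_linear : linear (@tensor_unit k V).
Proof. exact: (tlift_linear bl br). Qed.

HB.instance Definition _ := GRing.isLinear.Build k (tensor V k^o) V
  *:%R (@tensor_unit k V) tensor_unit_is_linear.

Lemma tensor_unit_bij : bijective (@tensor_unit k V).
Proof.
exists (fun v => tens v (1 : k^o)) => [x|v]; last first.
  by rewrite tensor_unit_tens scale1r.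
rewrite [in RHS](tensorE x) [in LHS](tensorE x) linear_sum.
rewrite -[LHS]/(tens_lmap V (1 : k^o) _) linear_sum; apply: eq_bigr => -[v c] _ /=.
rewrite !linearZ /= tensor_unit_tens -/(tens_lmap V (1 : k^o) (c *: v)) linearZ /=.
congr (_ *: _).
by rewrite -[c in RHS]mulr1 -[c * 1]/(c *: (1 : k^o)) linearZ.
Qed.
End TensorUnit.

Section QuotientAlgebra.
Context (k : fieldType) (R : comAlgType k) (J : idealr R).

Definition alg_quot := {ideal_quot J}.
HB.instance Definition _ := GRing.ComNzRing.on alg_quot.
HB.instance Definition _ := NzRingQuotient.on alg_quot.

Definition alg_quot_scale (c : k) : alg_quot -> alg_quot :=
  lift_op1 alg_quot ( *:%R c).

Lemma pi_alg_quot_scale c (p : R) :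
  \pi_alg_quot (c *: p) = alg_quot_scale c (\pi_alg_quot p).
Proof.
unlock alg_quot_scale; apply/eqP; rewrite -Quotient.idealrBE -scalerBr.
by rewrite -mulr_algl idealMr // Quotient.idealrBE reprK.
Qed.

Lemma alg_quot_scalerA a b x :
  alg_quot_scale a (alg_quot_scale b x) = alg_quot_scale (a * b) x.
Proof. by rewrite -[x]reprK -!pi_alg_quot_scale scalerA. Qed.
Lemma alg_quot_scale1r : left_id 1 alg_quot_scale.
Proof. by move=> x; rewrite -[x]reprK -!pi_alg_quot_scale scale1r. Qed.
Lemma alg_quot_scalerDr : right_distributive alg_quot_scale +%R.
Proof.
move=> a x y; rewrite -[x]reprK -[y]reprK -raddfD -!pi_alg_quot_scale.
by rewrite -raddfD scalerDr.
Qed.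
Lemma alg_quot_scalerDl x : {morph alg_quot_scale^~ x : a b / a + b}.
Proof. by move=> a b; rewrite -[x]reprK -!pi_alg_quot_scale -raddfD scalerDl. Qed.

HB.instance Definition _ := GRing.Zmodule_isLmodule.Build k alg_quot
  alg_quot_scalerA alg_quot_scale1r alg_quot_scalerDr alg_quot_scalerDl.

Lemma alg_quot_scalerAl (c : k) (x y : alg_quot) : c *: (x * y) = c *: x * y.
Proof.
rewrite -[x]reprK -[y]reprK -rmorphM /= /GRing.scale /= -!pi_alg_quot_scale.
by rewrite -rmorphM /= scalerAl.
Qed.

HB.instance Definition _ :=
  GRing.Lmodule_isLalgebra.Build k alg_quot alg_quot_scalerAl.
HB.instance Definition _ := GRing.Lalgebra_isComAlgebra.Build k alg_quot.

Definition alg_proj : R -> alg_quot := \pi_alg_quot.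
HB.instance Definition _ := GRing.RMorphism.on alg_proj.
HB.instance Definition _ := GRing.isScalable.Build k R alg_quot *:%R
  alg_proj pi_alg_quot_scale.

Lemma alg_proj0 (p : R) : p \in J -> alg_proj p = 0.
Proof.
move=> pJ; rewrite /alg_proj -(raddf0 \pi_alg_quot); apply/eqP.
by rewrite -Quotient.idealrBE subr0.
Qed.

End QuotientAlgebra.

(* {cmonom X} is the free commutative monoid on X, so {malg k[{cmonom X}]} is the
   polynomial ring over k in the commuting variables X; here I may be infinite.
   The variable X_(s, i) is locked because comparing two distinct variables by
   computation is prohibitively slow. *)
HB.lock Definition uvar (k : fieldType) (n : nat) (I : choiceType)
    (s : 'I_n) (i : I) : {malg k[{cmonom ('I_n * I)%type}]} :=
  << ucm (s, i) >>.

(* For bases of h and g, tau s t a is the coefficient of e_a in [e_s, e_t], and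
   beta i j u that of f_u in [f_i, f_j] for u in the finite set B i j; A(h, g)
   depends on h and g only through these structure constants. *)
Section UniversalAlgebra.
Context (k : fieldType) (n : nat) (I : choiceType).
Context (tau : 'I_n -> 'I_n -> 'I_n -> k).
Context (B : I -> I -> {fset I}) (beta : I -> I -> I -> k).

Local Notation upoly := {malg k[{cmonom ('I_n * I)%type}]}.
Local Notation uvar := (@uvar k n I).

Definition urel (a : 'I_n) (i j : I) : upoly :=
  \sum_(u <- B i j) beta i j u *: uvar a u
  - \sum_(s < n) \sum_(t < n) tau s t a *: (uvar s i * uvar t j).

(* The ideal generated by all the [urel a i j]. *)
Inductive urel_ideal : upoly -> Prop :=
| UrelIdeal0 : urel_ideal 0
| UrelIdealD p q : urel_ideal p -> urel_ideal q -> urel_ideal (p + q)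
| UrelIdealM p a i j : urel_ideal (p * urel a i j).

Definition uideal : {pred upoly} := fun p => `[< urel_ideal p >].

Lemma urel_idealM p q : urel_ideal q -> urel_ideal (p * q).
Proof.
elim=> [|x y _ hx _ hy|x a i j].
- by rewrite mulr0; apply: UrelIdeal0.
- by rewrite mulrDr; apply: UrelIdealD.
- by rewrite mulrA; apply: UrelIdealM.
Qed.

Lemma urel_constant_term a i j : (urel a i j)@_mone = 0.
Proof.
have X0 s l : (uvar s l)@_mone = 0.
  by rewrite uvar.unlock mcoeffU cm1_eq1.
have XX0 s l (p : upoly) : (uvar s l * p)@_mone = 0.
  by rewrite rmorphM /= X0 mul0r.
have sum0 (T : Type) (r : seq T) (F : T -> upoly) :
    (forall x, (F x)@_mone = 0) -> (\sum_(x <- r) F x)@_mone = 0.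
  by move=> F0; elim/big_ind: _ => [|p q hp hq|x _];
    rewrite ?mcoeff0 ?mcoeffD ?hp ?hq ?addr0.
rewrite mcoeffB !sum0 ?subrr // => [s|u]; last by rewrite mcoeffZ X0 mulr0.
by apply: sum0 => t; rewrite mcoeffZ XX0 mulr0.
Qed.

Lemma uideal_closed : idealr_closed uideal.
Proof.
split.
- exact/asboolP/UrelIdeal0.
- apply/negP => /asboolP h.
  have /eqP : (1 : upoly)@_mone = 0.
    elim: h => [|x y _ hx _ hy|x a i j].
    + exact: mcoeff0.
    + by rewrite mcoeffD hx hy addr0.
    + by rewrite rmorphM /= urel_constant_term mulr0.
  by rewrite mcoeff1 eqxx oner_eq0.
- move=> a x y /asboolP hx /asboolP hy; apply/asboolP.
  by apply: UrelIdealD => //; apply: urel_idealM.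
Qed.

HB.instance Definition _ := isIdealr.Build upoly uideal uideal_closed.

Definition ualg : Type := alg_quot uideal.
HB.instance Definition _ := GRing.ComAlgebra.on ualg.

Definition ugen (s : 'I_n) (i : I) : ualg := alg_proj uideal (uvar s i).

Lemma ugen_rel a i j :
  \sum_(u <- B i j) beta i j u *: ugen a u
  = \sum_(s < n) \sum_(t < n) tau s t a *: (ugen s i * ugen t j).
Proof.
have : alg_proj uideal (urel a i j) = 0.
  apply/alg_proj0/asboolP.
  by rewrite -[urel _ _ _]mul1r; apply: UrelIdealM.
rewrite /urel raddfB /= => /eqP; rewrite subr_eq0 => /eqP.
rewrite [LHS]linear_sum [RHS]linear_sum /=.
under eq_bigr => u _ do rewrite linearZ.
move=> ->; apply: eq_bigr => s _; rewrite linear_sum; apply: eq_bigr => t _.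
by rewrite linearZ rmorphM.
Qed.

End UniversalAlgebra.

Section Gamma.
Context (k : fieldType) (g : leibnizType k) (h : fdLeibnizType k).
Context (n : nat) (e : n.-tuple h) (tau : 'I_n -> 'I_n -> 'I_n -> k).
Context (I : choiceType) (f : I -> g) (hf : is_basis f).
Context (B : I -> I -> {fset I}) (beta : I -> I -> I -> k).

Local Notation A := (ualg tau B beta).

Definition eta : g -> tensor h A :=
  linext hf (fun i => \sum_(s < n) tens e`_s (ugen tau B beta s i)).

HB.instance Definition _ := GRing.Linear.on eta.

Definition gamma_fun (theta : {lrmorphism A -> k^o}) : g -> h :=
  @tensor_unit k h \o tmap idfun theta \o eta.

HB.instance Definition _ theta := GRing.Linear.on (gamma_fun theta).

Lemma gamma_funE theta i :
  gamma_fun theta (f i) = \sum_(s < n) (theta (ugen tau B beta s i) : k) *: e`_s.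
Proof.
rewrite /gamma_fun /= /eta linext_basis.
rewrite (linear_sum (tmap idfun theta)) (linear_sum (@tensor_unit k h)) /=.
by apply: eq_bigr => s _; rewrite tmap_tens tensor_unit_tens.
Qed.

Hypothesis htau : forall i j : 'I_n, lbr e`_i e`_j = \sum_(s < n) tau i j s *: e`_s.
Hypothesis hbeta : forall i j, lbr (f i) (f j) = \sum_(u <- B i j) beta i j u *: f u.

Lemma lbr_suml (L : leibnizType k) (J : Type) (r : seq J) (c : J -> k) x y :
  lbr (\sum_(j <- r) c j *: x j) y = \sum_(j <- r) c j *: lbr (x j) y :> L.
Proof.
elim: r => [|j r IHr]; last by rewrite !big_cons lbr_linear_l IHr.
rewrite !big_nil; have := lbr_linear_l y (-1) 0 0.
by rewrite scaler0 addr0 scaleN1r addNr.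
Qed.

Lemma lbr_sumr (L : leibnizType k) (J : Type) (r : seq J) (c : J -> k) x y :
  lbr x (\sum_(j <- r) c j *: y j) = \sum_(j <- r) c j *: lbr x (y j) :> L.
Proof.
elim: r => [|j r IHr]; last by rewrite !big_cons lbr_linear_r IHr.
rewrite !big_nil; have := lbr_linear_r x (-1) 0 0.
by rewrite scaler0 addr0 scaleN1r addNr.
Qed.

Lemma gamma_funM theta : {morph gamma_fun theta : x y / lbr x y >-> lbr x y}.
Proof.
pose G : {linear g -> h} := gamma_fun theta.
have on_basis i j : G (lbr (f i) (f j)) = lbr (G (f i)) (G (f j)).
  rewrite hbeta linear_sum /=; under eq_bigr => u _.
    rewrite linearZ [G (f u)]gamma_funE /= scaler_sumr; over.
  rewrite exchange_big [G (f i)]gamma_funE [G (f j)]gamma_funE lbr_suml /=.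
  under [RHS]eq_bigr => s _.
    rewrite lbr_sumr scaler_sumr; under eq_bigr => t _.
      rewrite htau scalerA scaler_sumr; over.
    over.
  rewrite /=; under [RHS]eq_bigr => s _ do rewrite exchange_big.
  rewrite [RHS]exchange_big /=; apply: eq_bigr => a _.
  transitivity ((theta (\sum_(u <- B i j) beta i j u *: ugen tau B beta a u) : k)
                 *: e`_a).
    rewrite linear_sum /= scaler_suml; apply: eq_bigr => u _.
    by rewrite [theta (_ *: _)]linearZ scalerA.
  rewrite ugen_rel linear_sum /= scaler_suml; apply: eq_bigr => s _.
  rewrite linear_sum /= scaler_suml; apply: eq_bigr => t _.
  rewrite [theta (_ *: _)]linearZ rmorphM scalerA; congr (_ *: _).
  exact: mulrC.
move=> x y; rewrite -![gamma_fun theta _]/(G _); move: x.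
apply: (eq_on_basis hf (p := fun x => G (lbr x y))) => [a x x'|a x x'|i].
- by rewrite lbr_linear_l linearP.
- by rewrite linearP lbr_linear_l.
move: y; apply: (eq_on_basis hf) => [a y y'|a y y'|j] //.
- by rewrite lbr_linear_r linearP.
- by rewrite linearP lbr_linear_r.
Qed.

Definition gamma (theta : {lrmorphism A -> k^o}) : lbzHom g h :=
  LbzHom (gamma_funM theta).

End Gamma.

(* Main.v *)
(** An algebra morphism [A(h, g) -> k] is a family [c s i] of scalars satisfying
    the defining relations of [A(h, g)], and these relations say exactly that
    the linear map [f i |-> \sum_s c s i *: e_s] preserves brackets. *)

Require Import Defs.
From HB Require Import structures.
From mathcomp Require Import all_boot all_algebra.
From mathcomp Require Import boolp xfinmap monalg.

Set Implicit Arguments.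
Unset Strict Implicit.
Unset Printing Implicit Defensive.

Import GRing.Theory.
Local Open Scope ring_scope.

(** * Extensionality of bundled morphisms, by proof irrelevance of their axioms *)

Lemma linear_ext (k : fieldType) (U V : lmodType k) (p q : {linear U -> V}) :
  p =1 q -> p = q.
Proof.
case: p q => [p [[pA] [pZ]]] [q [[qA] [qZ]]] /= /funext pq.
move: pA pZ qA qZ; rewrite pq => pA pZ qA qZ.
by rewrite (Prop_irrelevance pA qA) (Prop_irrelevance pZ qZ).
Qed.

Lemma lrmorphism_ext (k : fieldType) (R S : algType k)
    (p q : {lrmorphism R -> S}) :
  p =1 q -> p = q.
Proof.
case: p q => [p [[pA] [pM] [pZ]]] [q [[qA] [qM] [qZ]]] /= /funext pq.
move: pA pM pZ qA qM qZ; rewrite pq => pA pM pZ qA qM qZ.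
by rewrite (Prop_irrelevance pA qA) (Prop_irrelevance pM qM)
  (Prop_irrelevance pZ qZ).
Qed.

Lemma lbzHom_ext (k : fieldType) (g h : leibnizType k) (p q : lbzHom g h) :
  p =1 q -> p = q.
Proof.
case: p q => [p pM] [q qM] /= /linear_ext pq.
by case: q / pq in qM *; rewrite (Prop_irrelevance pM qM).
Qed.

(* The next two lemmas are stated for abstract monomials because unification on
   concrete ones of type {cmonom X} does not terminate in reasonable time. *)
Lemma monalgUZ1 (k : fieldType) (K : choiceType) (c : k) (m : K) :
  c *: << m >> = << c *g m >> :> {malg k[K]}.
Proof. by apply/malgP=> m'; rewrite mcoeffZ !mcoeffU mulr_natr. Qed.

Lemma monalgUM1 (k : fieldType) (K : monomType) (m1 m2 : K) :
  << m1 >> * << m2 >> = << mmul m1 m2 >> :> {malg k[K]}.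
Proof. by rewrite malgM_def fgmulUU mulr1. Qed.

(** * Commutative monomials: induction and evaluation *)

Section CommutativeMonomials.
Context (X : choiceType).

(** Induction on the degree: a monomial other than [mone] contains some variable, and dividing by it
    lowers the degree by one. *)
Lemma cmonom_ind (P : {cmonom X} -> Prop) :
  P mone -> (forall i m, P m -> P (mmul (ucm i) m)) -> forall m, P m.
Proof.
move=> P1 PM m; have [d] := ubnP (mdeg m); elim: d m => // d IHd m.
have [->//|] := eqVneq m mone; rewrite -mdeg_eq0 mdegE => m_neq0 m_lt.
have [i im] : exists i, i \in finsupp m.
  apply/fset0Pn; apply: contra m_neq0 => /eqP->.
  by rewrite big_seq_fset0.
(* [divcm] subtracts exponents with truncation, so this factorization relies on [i] having a
   positive exponent in [m]. *)
have mE : m = mmul (ucm i) (divcm m (ucm i)).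
  apply/eqP/cmP => j; rewrite cmM divcmE subnKC // ucmE.
  by case: eqVneq => [<-|//]; rewrite lt0n cmE_neq0.
rewrite mE; apply/PM/IHd; move: m_lt.
by rewrite -mdegE [in mdeg m]mE mdegM mdegU.
Qed.

Context (S : comNzRingType) (v : X -> S).

Definition cmeval (m : {cmonom X}) : S := \prod_(i <- finsupp m) v i ^+ m i.

(** Exponents vanish outside the support. This lets two monomials be multiplied over the union of
    their supports. *)
Lemma cmevalEw (m : {cmonom X}) (d : {fset X}) :
  (finsupp m `<=` d)%fset -> cmeval m = \prod_(i <- d) v i ^+ m i.
Proof.
move=> le; rewrite /cmeval (big_fset_incl _ le) // => i _.
by rewrite memNfinsupp => /eqP->; rewrite expr0.
Qed.

Lemma cmevalU i : cmeval (ucm i) = v i.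
Proof. by rewrite /cmeval mdomU big_seq_fset1 cmUU expr1. Qed.

Lemma cmeval_mmorphism : mmorphism cmeval.
Proof.
split=> [m1 m2|]; last by rewrite /cmeval mdom1 big_seq_fset0.
rewrite [LHS]/cmeval mdomD.
rewrite (cmevalEw (fsubsetUl _ (finsupp m2))).
rewrite (cmevalEw (fsubsetUr (finsupp m1) _)) -big_split /=.
by apply: eq_bigr => i _; rewrite cmM exprD.
Qed.

HB.instance Definition _ :=
  monalg.isMultiplicative.Build {cmonom X} S cmeval cmeval_mmorphism.

End CommutativeMonomials.

(** * The universal property of polynomial algebras *)

Section PolynomialEvaluation.
Context (k : fieldType) (X : choiceType) (S : comAlgType k).

Definition peval (v : X -> S) : {malg k[{cmonom X}]} -> S :=
  mmap (in_alg S) (cmeval v).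

HB.instance Definition _ v := GRing.RMorphism.on (peval v).

Lemma peval_is_scalable v : scalable (peval v).
Proof. by move=> c p; rewrite /peval mmapZ /= mulr_algl. Qed.

HB.instance Definition _ v := GRing.isScalable.Build k {malg k[{cmonom X}]} S
  *:%R (peval v) (peval_is_scalable v).

Lemma pevalU v i : peval v << ucm i >> = v i.
Proof. by rewrite /peval mmapU cmevalU /= scale1r mul1r. Qed.

(** Linearity reduces the claim to monomials, and multiplicativity reduces monomials to variables by
    [cmonom_ind]. *)
Lemma eq_on_ucm (p q : {lrmorphism {malg k[{cmonom X}]} -> S}) :
  (forall i, p << ucm i >> = q << ucm i >>) -> p =1 q.
Proof.
move=> pq x; rewrite [x]monalgE !raddf_sum; apply: eq_bigr => m _ /=.
rewrite -monalgUZ1 !linearZ /=; congr (_ *: _).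
elim/cmonom_ind: m => [|i m IHm].
  by rewrite -[1%:MP]/(1 : {malg k[{cmonom X}]}) !rmorph1.
rewrite -monalgUM1 (rmorphM p) (rmorphM q); congr (_ * _); last exact: IHm.
exact: pq.
Qed.

End PolynomialEvaluation.

(** * Algebra morphisms out of a quotient *)

Section QuotientLift.
Context (k : fieldType) (R : comAlgType k) (J : idealr R) (S : algType k).
Context (p : {lrmorphism R -> S}) (pJ : forall x, x \in J -> p x = 0).

Definition quot_lift (x : alg_quot J) : S := p (repr x).

(** The chosen representative of the class of [x] differs from [x] by an element of [J], which [p]
    kills. *)
Lemma quot_lift_proj x : quot_lift (alg_proj J x) = p x.
Proof.
apply/eqP; rewrite -subr_eq0 -raddfB; apply/eqP/pJ.
by rewrite Quotient.idealrBE reprK.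
Qed.

(** This is [reprK] phrased with [alg_proj], so that the morphism laws of the projection can be
    rewritten with. *)
Lemma alg_projK (x : alg_quot J) : alg_proj J (repr x) = x.
Proof. exact: reprK. Qed.

Lemma quot_lift_is_additive : zmod_morphism quot_lift.
Proof.
move=> x y; rewrite -[x]alg_projK -[y]alg_projK -raddfB !quot_lift_proj.
exact: raddfB.
Qed.

Lemma quot_lift_is_multiplicative : monoid_morphism quot_lift.
Proof.
split=> [|x y]; first by rewrite -(rmorph1 (alg_proj J)) quot_lift_proj rmorph1.
rewrite -[x]alg_projK -[y]alg_projK -rmorphM !quot_lift_proj.
exact: rmorphM.
Qed.

Lemma quot_lift_is_scalable : scalable quot_lift.
Proof.
move=> c x; rewrite -[x]alg_projK -linearZ !quot_lift_proj.
exact: linearZ.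
Qed.

Definition quot_lrmorphism : {lrmorphism alg_quot J -> S} :=
  HB.pack_for {lrmorphism alg_quot J -> S} quot_lift
    (GRing.isZmodMorphism.Build _ _ quot_lift quot_lift_is_additive)
    (GRing.isMonoidMorphism.Build _ _ quot_lift quot_lift_is_multiplicative)
    (GRing.isScalable.Build k _ _ *:%R quot_lift quot_lift_is_scalable).

End QuotientLift.

(** * The universal property of the algebra A(h, g) *)

Section UniversalAlgebraLift.
Context (k : fieldType) (n : nat) (I : choiceType).
Context (tau : 'I_n -> 'I_n -> 'I_n -> k).
Context (B : I -> I -> {fset I}) (beta : I -> I -> I -> k).
Context (S : comAlgType k).

Local Notation upoly := {malg k[{cmonom ('I_n * I)%type}]}.
Local Notation A := (ualg tau B beta).

Lemma eq_on_ugen (p q : {lrmorphism A -> S}) :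
  (forall s i, p (ugen tau B beta s i) = q (ugen tau B beta s i)) -> p =1 q.
Proof.
move=> pq x; rewrite -[x]alg_projK; set J := uideal tau B beta.
(* Both morphisms are pulled back to the polynomial algebra, where agreement on variables
   suffices. *)
pose P : {lrmorphism upoly -> S} := p \o alg_proj J.
pose Q : {lrmorphism upoly -> S} := q \o alg_proj J.
suff PQ : P =1 Q by exact: PQ.
by apply: eq_on_ucm => -[s i]; have := pq s i; rewrite /ugen uvar.unlock.
Qed.

Context (c : 'I_n -> I -> S).
Hypothesis c_rel : forall a i j, \sum_(u <- B i j) beta i j u *: c a u
  = \sum_(s < n) \sum_(t < n) tau s t a *: (c s i * c t j).

Local Notation ev := (peval (fun x : ('I_n * I)%type => c x.1 x.2)).

Lemma peval_uvar s i : ev (uvar k s i) = c s i.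
Proof. by rewrite uvar.unlock pevalU. Qed.

Lemma peval_uideal x : x \in uideal tau B beta -> ev x = 0.
Proof.
move=> /asboolP; elim=> [|y z _ hy _ hz|y a i j].
- exact: raddf0.
- by rewrite raddfD /= hy hz addr0.
(* It remains to evaluate the generator [urel a i j], whose two halves become the two sides of
   [c_rel]. *)
rewrite rmorphM /= [X in _ * X](_ : _ = 0) ?mulr0 //.
rewrite /urel raddfB /=; apply/eqP; rewrite subr_eq0 !linear_sum; apply/eqP.
under eq_bigr => u _ do rewrite linearZ /= peval_uvar.
rewrite c_rel; apply: eq_bigr => s _; rewrite linear_sum.
by apply: eq_bigr => t _; rewrite linearZ /= rmorphM /= !peval_uvar.
Qed.

Definition ualg_lift : {lrmorphism A -> S} := quot_lrmorphism peval_uideal.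

Lemma ualg_lift_ugen s i : ualg_lift (ugen tau B beta s i) = c s i.
Proof.
exact: etrans (quot_lift_proj peval_uideal (uvar k s i)) (peval_uvar s i).
Qed.

End UniversalAlgebraLift.

(** * The inverse of [gamma] *)

Section GammaBijective.
Context (k : fieldType) (g : leibnizType k) (h : fdLeibnizType k).
Context (n : nat) (e : n.-tuple h) (he : basis_of fullv e).
Context (tau : 'I_n -> 'I_n -> 'I_n -> k).
Hypothesis htau : forall i j : 'I_n,
  lbr e`_i e`_j = \sum_(s < n) tau i j s *: e`_s.
Context (I : choiceType) (f : I -> g) (hf : is_basis f).
Context (B : I -> I -> {fset I}) (beta : I -> I -> I -> k).
Hypothesis hbeta : forall i j : I,
  lbr (f i) (f j) = \sum_(u <- B i j) beta i j u *: f u.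

(** The coordinates of the image of [f i] in the basis [e] are the values at the generators
    [ugen s i], which determine an algebra morphism. *)
Lemma gamma_inj : injective (gamma hf htau hbeta).
Proof.
move=> p q pq; apply/lrmorphism_ext/eq_on_ugen => s i.
have : gamma_fun e hf p (f i) = gamma_fun e hf q (f i).
  by rewrite -[LHS]/(gamma hf htau hbeta p (f i)) pq.
rewrite !gamma_funE => /(congr1 (coord e s)).
by rewrite !coord_sum_free ?(basis_free he).
Qed.

Context (F : lbzHom g h).

(** Both sides are the [e_a] coordinate of the image under [F] of the bracket of [f i] and [f j]:
    expand the bracket in [g] first, or push [F] inside and expand in [h]. *)
Lemma coord_lbzHom_rel a i j :
  \sum_(u <- B i j) beta i j u *: (coord e a (F (f u)) : k^o)
  = \sum_(s < n) \sum_(t < n)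
      tau s t a *: ((coord e s (F (f i)) : k^o) * coord e t (F (f j))).
Proof.
have -> : \sum_(u <- B i j) beta i j u *: (coord e a (F (f u)) : k^o)
    = coord e a (F (lbr (f i) (f j))).
  rewrite hbeta !linear_sum; apply: eq_bigr => u _.
  by rewrite !linearZ.
rewrite lbz_funE.
(* Only the arguments of the bracket are expanded; the coordinates on the right-hand side stay
   intact. *)
rewrite {1}(coord_basis he (memvf (F (f i)))).
rewrite {1}(coord_basis he (memvf (F (f j)))).
rewrite lbr_suml linear_sum; apply: eq_bigr => s _.
rewrite lbr_sumr linearZ linear_sum /= mulr_sumr; apply: eq_bigr => t _.
rewrite htau linearZ /= coord_sum_free ?(basis_free he) //.
by rewrite mulrA mulrC.
Qed.

(** The [k]-point sending each generator [ugen s i] to the [e_s] coordinate of [F (f i)]. *)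
Definition lbzHom_point : {lrmorphism ualg tau B beta -> k^o} :=
  ualg_lift coord_lbzHom_rel.

Lemma lbzHom_pointK : gamma hf htau hbeta lbzHom_point = F.
Proof.
apply: lbzHom_ext; apply: (eq_on_basis hf); [exact: linearP..|] => i /=.
rewrite gamma_funE [RHS](coord_basis he (memvf _)).
by apply: eq_bigr => s _; rewrite ualg_lift_ugen.
Qed.

End GammaBijective.

Theorem corollary2p3 (k : fieldType) (g : leibnizType k) (h : fdLeibnizType k)
    (n : nat) (e : n.-tuple h) (he : basis_of fullv e)
    (tau : 'I_n -> 'I_n -> 'I_n -> k)
    (htau : forall i j : 'I_n, lbr e`_i e`_j = \sum_(s < n) tau i j s *: e`_s)
    (I : choiceType) (f : I -> g) (hf : is_basis f)
    (B : I -> I -> {fset I}) (beta : I -> I -> I -> k)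
    (hbeta : forall i j : I,
       lbr (f i) (f j) = \sum_(u <- B i j) beta i j u *: f u) :
  bijective (gamma hf htau hbeta
    : {lrmorphism ualg tau B beta -> k^o} -> lbzHom g h).
Proof.
(* A right inverse of an injective map is also a left inverse. *)
exists (lbzHom_point he htau hbeta) => [p|]; last exact: lbzHom_pointK.
by apply: (gamma_inj he (hf := hf)); apply: lbzHom_pointK.
Qed.
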